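(* For every signed graph $\Sigma=(G,\sigma)$, \[ \mathcal H_0^\sigma(\Sigma)\cong\ker L^\sigma(\Sigma). \] Consequently, the dimension of $\mathcal H_0^\sigma(\Sigma)$ is the number of balanced connected components of $\Sigma$.
   Context: Signed graphs. A signed graph is a pair $\Sigma=(G,\sigma)$ with $G=(V,E)$ a finite simple graph and $\sigma:E\to\{+1,-1\}$. The sign of a cycle $v_0v_1\cdots v_{k-1}v_0$ ($k\ge3$, $v_0,\dots,v_{k-1}$ distinct, consecutive vertices adjacent) is the product of the signs of its edges. A connected component is balanced if every cycle in it has sign $+1$. The signed Laplacian is $L^\sigma(\Sigma)=D_G-A_\sigma$, acting on real vectors indexed by $V$, where $D_G$ is the diagonal degree matrix of $G$ and $(A_\sigma)_{uv}=\sigma(uv)$ if $uv\in E$ and $0$ otherwise. Signed digraphs. A signed digraph is a pair $(D,\sigma)$ where $D=(V,A)$ is a finite loopless digraph with at most one arrow from $i$ to $j$ for each ordered pair $(i,j)$, and $\sigma:A\to\{+1,-1\}$. The signed double cover $\widetilde D_\sigma$ is the digraph with vertices $i^\varepsilon=(i,\varepsilon)\in V\times\{+1,-1\}$ and arrows $i^\varepsilon\to j^{\varepsilon\sigma(ij)}$ for each arrow $i\to j$ of $D$ and each $\varepsilon$; the deck involution is $\tau(i^\varepsilon)=i^{-\varepsilon}$, acting on paths vertexwise. Signed GLMY homology (over $\mathbb R$). A $p$-path on $V\times\{+1,-1\}$ is a sequence of $p+1$ lifted vertices; it is regular if consecutive lifted vertices are distinct and allowed if consecutive lifted vertices are joined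 by arrows of $\widetilde D_\sigma$. $\mathcal R_p(\widetilde D_\sigma)$ is the real vector space with basis $e_{\widetilde\gamma}$, $\widetilde\gamma$ a regular $p$-path (no arrow condition), with boundary $e_{v_0\cdots v_p}\mapsto\sum_{q=0}^p(-1)^qe_{v_0\cdots\widehat{v_q}\cdots v_p}$ for $p\ge1$ (nonregular terms are zero), and zero boundary for $p=0$. $R_p^\sigma(D)$ is the quotient of $\mathcal R_p(\widetilde D_\sigma)$ by the span of all $e_{\tau\widetilde\gamma}+e_{\widetilde\gamma}$; the boundary induces $\partial^\sigma_{\mathrm{reg},p}:R_p^\sigma(D)\to R_{p-1}^\sigma(D)$ (zero for $p=0$). $\mathcal A_p^\sigma(D)\subseteq R_p^\sigma(D)$ is the span of the classes of allowed paths. Set $\Omega_0^\sigma(D)=\mathcal A_0^\sigma(D)$, $\Omega_p^\sigma(D)=\{z\in\mathcal A_p^\sigma(D):\partial^\sigma_{\mathrm{reg},p}z\in\mathcal A^\sigma_{p-1}(D)\}$ for $p\ge1$, $\Omega_{-1}^\sigma(D)=0$, with boundary $\partial_p^\sigma$ the restriction of $\partial^\sigma_{\mathrm{reg},p}$. $H_p^\sigma(D)$ is the homology of $(\Omega_\bullet^\sigma(D),\partial_*^\sigma)$. Canonical signed GLMY homology. For a signed graph $\Sigma=(G,\sigma)$, the bidirected completion $\overleftrightarrow\Sigma$ is the signed digraph obtained by replacing every edge $uv$ by the two arrows $u\to v$ and $v\to u$, both with sign $\sigma(uv)$. Define $\mathcal H_p^\sigma(\Sigma):=H_p^\sigma(\overleftrightarrow\Sigma)$.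 *)

(* Defs.v *)
From HB Require Import structures.
From mathcomp Require Import all_boot all_order all_algebra.
From mathcomp Require Import ring_quotient.

Set Implicit Arguments.
Unset Strict Implicit.
Unset Printing Implicit Defensive.

Import GRing.Theory.
Local Open Scope ring_scope.
Local Open Scope quotient_scope.

(* The library has quotients of additive groups ([Quotient.quot]) but not of
   vector spaces: this section adds scaling and finite dimension to the additive
   quotient of [vT] by a subspace [U]. *)
Section VectorQuotient.
Variables (K : fieldType) (vT : vectType K) (U : {vspace vT}).

Definition vquot := Quotient.quot (pred_of_vspace U).
HB.instance Definition _ :=
  GRing.Zmodule.copy vquot (Quotient.quot (pred_of_vspace U)).

Definition vquot_pi (x : vT) : vquot := \pi_(Quotient.quot (pred_of_vspace U)) x.

Lemma vquot_piE x y : (vquot_pi x == vquot_pi y) = (x - y \in U).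
Proof. by rewrite /vquot_pi eqmodE. Qed.

Lemma vquot_reprK (q : vquot) : vquot_pi (repr q) = q.
Proof. exact: reprK. Qed.

Lemma vquot_piB x y : vquot_pi (x - y) = vquot_pi x - vquot_pi y.
Proof. exact: raddfB. Qed.

Lemma vquot_piD x y : vquot_pi (x + y) = vquot_pi x + vquot_pi y.
Proof. exact: raddfD. Qed.

Definition vquot_scale (a : K) (q : vquot) : vquot := vquot_pi (a *: repr q).

Lemma vquot_piZ a x : vquot_pi (a *: x) = vquot_scale a (vquot_pi x).
Proof.
apply/eqP; rewrite vquot_piE -scalerBr memvZ // -vquot_piE.
by rewrite vquot_reprK.
Qed.

Fact vquot_scaleA a b q : vquot_scale a (vquot_scale b q) = vquot_scale (a * b) q.
Proof. by rewrite -[q]vquot_reprK -!vquot_piZ scalerA. Qed.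
Fact vquot_scale1 : left_id 1 vquot_scale.
Proof. by move=> q; rewrite -[q]vquot_reprK -vquot_piZ scale1r. Qed.
Fact vquot_scaleDr : right_distributive vquot_scale +%R.
Proof.
move=> a q r; rewrite -[q]vquot_reprK -[r]vquot_reprK.
by rewrite -vquot_piD -!vquot_piZ -vquot_piD scalerDr.
Qed.
Fact vquot_scaleDl q : {morph vquot_scale^~ q : a b / a + b}.
Proof.
by move=> a b /=; rewrite -[q]vquot_reprK -!vquot_piZ -vquot_piD scalerDl.
Qed.
HB.instance Definition _ := GRing.Zmodule_isLmodule.Build K vquot
  vquot_scaleA vquot_scale1 vquot_scaleDr vquot_scaleDl.

Fact vquot_pi_is_linear : linear vquot_pi.
Proof. by move=> a x y; rewrite vquot_piD vquot_piZ. Qed.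
HB.instance Definition _ :=
  GRing.isLinear.Build K vT vquot *:%R vquot_pi vquot_pi_is_linear.

Fact vquot_vect_iso : Vector.axiom (\dim U^C) vquot.
Proof.
have [g g_lin g_bij] := subvs_vect_iso (U^C)%VS.
have UC : (U^C :&: U = 0)%VS by rewrite capvC capv_compl.
have CU : (U :&: U^C = 0)%VS by rewrite capv_compl.
pose psi (x : vT) := vsproj U^C (daddv_pi U^C U x).
have psi_lin a x y : psi (a *: x + y) = a *: psi x + psi y.
  by rewrite /psi !linearP.
have psi_repr x : psi (repr (vquot_pi x)) = psi x.
  apply/eqP; rewrite -subr_eq0 -[_ - psi x]addrC -scaleN1r -psi_lin; apply/eqP.
  set z := _ + _.
  have zU : z \in U.
    by rewrite /z scaleN1r addrC -vquot_piE vquot_reprK.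
  have dz : daddv_pi U^C U z = 0.
    have := daddv_pi_add UC (subvP (addvSr U^C U) _ zU).
    by rewrite (daddv_pi_id CU zU) => /eqP; rewrite -subr_eq0 addrK => /eqP.
  by rewrite /psi dz linear0.
exists (fun q => g (psi (repr q))).
  move=> a q r; rewrite -[q]vquot_reprK -[r]vquot_reprK -linearP !psi_repr.
  by rewrite psi_lin g_lin.
have [h gK hK] := g_bij; exists (fun r => vquot_pi (vsval (h r))) => [q|r].
  rewrite gK /psi vsprojK ?memv_pi // -[RHS]vquot_reprK.
  apply/eqP; rewrite vquot_piE -memvN opprB.
  have xT : repr q \in (U^C + U)%VS by rewrite addvC addv_complf memvf.
  by rewrite -{1}(daddv_pi_add UC xT) addrAC subrr add0r memv_pi.
rewrite psi_repr /psi daddv_pi_id ?subvsP //.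
by rewrite vsvalK hK.
Qed.
HB.instance Definition _ := Lmodule_hasFinDim.Build K vquot vquot_vect_iso.

End VectorQuotient.

(* The map [vquot U -> vquot W] induced by [f]; it is the expected one whenever
   [f] maps [U] into [W], see [vquot_mapE]. *)
Definition vquot_map (K : fieldType) (vT wT : vectType K)
    (U : {vspace vT}) (W : {vspace wT}) (f : 'Hom(vT, wT)) :
    'Hom(vquot U, vquot W) :=
  (linfun (vquot_pi W) \o f \o (linfun (vquot_pi U))^-1)%VF.

Lemma vquot_mapE (K : fieldType) (vT wT : vectType K)
    (U : {vspace vT}) (W : {vspace wT}) (f : 'Hom(vT, wT)) (x : vT) :
  (f @: U <= W)%VS -> vquot_map U W f (vquot_pi U x) = vquot_pi W (f x).
Proof.
move=> fUW; rewrite /vquot_map !comp_lfunE !lfunE /=.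
set y := ((linfun (vquot_pi U))^-1)%VF _.
have piy : vquot_pi U y = vquot_pi U x.
  have: vquot_pi U x \in limg (linfun (vquot_pi U)).
    by apply/memv_imgP; exists x; rewrite ?memvf ?lfunE.
  by move/limg_lfunVK; rewrite lfunE.
apply/eqP; rewrite vquot_piE -linearB (subvP fUW) // memv_img //.
by rewrite -vquot_piE piy.
Qed.

(* Signs are booleans throughout, [b] standing for [(-1) ^+ b]: [true] is the
   sign -1 and [(+)] is multiplication of signs. *)

(* [sg_sign u v] is the sign of the edge uv; its value is irrelevant when u and
   v are not adjacent. *)
Record sgraph (V : finType) := SGraph {
  sg_edge : rel V;
  sg_sign : V -> V -> bool;
  sg_edge_sym : symmetric sg_edge;
  sg_edge_irr : irreflexive sg_edge;
  sg_sign_sym : forall u v, sg_edge u v -> sg_sign u v = sg_sign v u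
}.

Record sdigraph (V : finType) := SDigraph {
  sd_arrow : rel V;
  sd_sign : V -> V -> bool;
  sd_arrow_irr : irreflexive sd_arrow
}.

Definition bidirected (V : finType) (S : sgraph V) : sdigraph V :=
  SDigraph (sg_sign S) (sg_edge_irr S).

Section SignedGraph.
Variables (V : finType) (S : sgraph V).

Definition is_cycle (c : seq V) := [&& (2 < size c)%N, cycle (sg_edge S) c & uniq c].

Definition cycle_sign (c : seq V) : int :=
  \prod_(v <- c) (-1) ^+ sg_sign S v (next c v).

Definition components : {set {set V}} :=
  equivalence_partition (connect (sg_edge S)) [set: V].

Definition balanced (C : {set V}) : Prop :=
  forall c : seq V, is_cycle c -> {subset c <= C} -> cycle_sign c = 1.

Variable R : fieldType.

Definition degree (u : V) : nat := #|[set v | sg_edge S u v]|.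

Definition adj_entry (u v : V) : R :=
  if sg_edge S u v then (-1) ^+ sg_sign S u v else 0.

Definition laplacian_entry (u v : V) : R :=
  (if u == v then (degree u)%:R else 0) - adj_entry u v.

Definition laplacian_fun (x : {ffun V -> R^o}) : {ffun V -> R^o} :=
  [ffun u => \sum_v laplacian_entry u v * x v].

Fact laplacian_fun_is_linear : linear laplacian_fun.
Proof.
move=> a x y; apply/ffunP=> u; rewrite !ffunE scaler_sumr -big_split /=.
by apply: eq_bigr => v _; rewrite !ffunE mulrDr mulrCA.
Qed.
HB.instance Definition _ := GRing.isLinear.Build R _ _ *:%R laplacian_fun
  laplacian_fun_is_linear.

Definition laplacian : 'End({ffun V -> R^o}) := linfun laplacian_fun.

End SignedGraph.

Section Paths.
Variable V : finType.

(* (i, b) is the lifted vertex i^((-1) ^ b). *)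
Definition lvertex : finType := (V * bool)%type.

Definition regular (s : seq lvertex) := sorted (fun x y => x != y) s.

Definition deck (x : lvertex) : lvertex := (x.1, ~~ x.2).

Definition cover_arrow (D : sdigraph V) : rel lvertex := fun x y =>
  sd_arrow D x.1 y.1 && (y.2 == x.2 (+) sd_sign D x.1 y.1).

Definition allowed (D : sdigraph V) (s : seq lvertex) := sorted (cover_arrow D) s.

Definition rpath (p : nat) : finType := {t : p.+1.-tuple lvertex | regular t}.

Definition rpath_seq p (g : rpath p) : seq lvertex := tval (val g).

Definition face (q : nat) (s : seq lvertex) := take q s ++ drop q.+1 s.

Lemma deckK : involutive deck.
Proof. by case=> i b; rewrite /deck /= negbK. Qed.

Lemma regular_deck s : regular (map deck s) = regular s.
Proof.
by rewrite /regular sorted_map; apply: eq_sorted => x y /=; rewrite (inj_eq (can_inj deckK)).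
Qed.

Lemma face_map q s : face q (map deck s) = map deck (face q s).
Proof. by rewrite /face -map_take -map_drop map_cat. Qed.

Lemma rpathP p (s : seq lvertex) : size s = p.+1 -> regular s ->
  exists g : rpath p, rpath_seq g = s.
Proof.
move=> /eqP sz reg; exists (exist _ (Tuple sz) reg : rpath p).
by [].
Qed.

Lemma face0 x (s : seq lvertex) : face 0 (x :: s) = s.
Proof. by rewrite /face /= drop0. Qed.

Lemma faceS q x (s : seq lvertex) : face q.+1 (x :: s) = x :: face q s.
Proof. by []. Qed.

Lemma face_face r q (s : seq lvertex) : (r <= q)%N ->
  face r (face q.+1 s) = face q (face r s).
Proof.
elim: s r q => [|x s IH] [|r] [|q] //= rq; rewrite ?faceS ?face0 //.
by rewrite IH.
Qed.

Lemma size_face q (s : seq lvertex) : (q < size s)%N -> size (face q s) = (size s).-1.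
Proof.
move=> lt; rewrite size_cat size_take size_drop lt.
by case: (size s) lt => // n lt; rewrite subSS subnKC.
Qed.

Lemma irregularP (s : seq lvertex) : ~~ regular s ->
  exists s1 x s2, s = s1 ++ x :: x :: s2.
Proof.
elim: s => // x [|y s] // IH; rewrite /regular /= negb_and negbK.
case/orP=> [/eqP<-|/IH[s1 [z [s2 ->]]]]; first by exists [::], x, s.
by exists (x :: s1), z, s2.
Qed.

Lemma irregular_cat (s1 : seq lvertex) x s2 : ~~ regular (s1 ++ x :: x :: s2).
Proof. by elim: s1 => [|y [|z s1] IH]; rewrite /regular /= ?eqxx ?negb_and ?IH ?orbT. Qed.

End Paths.

Section SignedGLMY.
Variables (R : fieldType) (V : finType).

Definition rchain (p : nat) : vectType R := {ffun rpath V p -> R^o}.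

(* The basis vector of the path [s], and 0 when [s] is not a regular p-path. *)
Definition evec (p : nat) (s : seq (lvertex V)) : rchain p :=
  [ffun g => (rpath_seq g == s)%:R].

Definition bd_fun (p : nat) (x : rchain p.+1) : rchain p :=
  \sum_(g : rpath V p.+1)
     x g *: \sum_(q < p.+2) (-1) ^+ q *: evec p (face q (rpath_seq g)).

Fact bd_fun_is_linear p : linear (@bd_fun p).
Proof.
move=> a x y; rewrite /bd_fun scaler_sumr -big_split /=.
by apply: eq_bigr => g _; rewrite !ffunE scalerDl scalerA.
Qed.
HB.instance Definition _ p := GRing.isLinear.Build R _ _ *:%R (@bd_fun p)
  (@bd_fun_is_linear p).

(* The boundary out of degree 0 is the zero map into degree 0.-1 = 0, so that no
   chain space in degree -1 is needed. *)
Definition bd (p : nat) : 'Hom(rchain p, rchain p.-1) :=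
  match p with
  | 0 => 0
  | p'.+1 => linfun (@bd_fun p')
  end.

Definition deck_rel (p : nat) : {vspace rchain p} :=
  <<[seq (evec p (map (@deck V) (rpath_seq g)) + evec p (rpath_seq g))%R
    | g : rpath V p]>>%VS.

Definition schain (p : nat) : vectType R := vquot (deck_rel p).

Definition sclass (p : nat) (s : seq (lvertex V)) : schain p :=
  vquot_pi (deck_rel p) (evec p s).

Definition sbd (p : nat) : 'Hom(schain p, schain p.-1) :=
  vquot_map (deck_rel p) (deck_rel p.-1) (bd p).

Lemma bd_evec p (s : seq (lvertex V)) : size s = p.+2 -> regular s ->
  bd p.+1 (evec p.+1 s) = \sum_(q < p.+2) (-1) ^+ q *: evec p (face q s).
Proof.
move=> sz reg; have [g gs] := rpathP sz reg.
rewrite lfunE /= /bd_fun (bigD1 g) //= ffunE gs eqxx scale1r.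
rewrite [X in _ + X]big1 ?addr0 //.
move=> h neq; rewrite ffunE -gs.
have -> : (rpath_seq h == rpath_seq g) = false.
  by apply: contraNF neq => /eqP hg; apply/eqP/val_inj/val_inj.
by rewrite scale0r.
Qed.

Lemma evec_irregular p s : ~~ regular s -> evec p s = 0.
Proof.
move=> reg; apply/ffunP => g; rewrite !ffunE; case: eqP => // gs.
by rewrite -gs /rpath_seq (valP g) in reg.
Qed.

Lemma evec_deck_rel p s : size s = p.+1 ->
  evec p (map (@deck V) s) + evec p s \in deck_rel p.
Proof.
move=> sz; have [reg|irr] := boolP (regular s).
  have [g <-] := rpathP sz reg; apply: memv_span.
  by apply/mapP; exists g; rewrite ?mem_enum.
by rewrite !evec_irregular ?regular_deck // addr0 mem0v.
Qed.

Lemma bd_deck_rel p : (bd p @: deck_rel p <= deck_rel p.-1)%VS.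
Proof.
case: p => [|p]; first by rewrite /bd /= lim0g sub0v.
rewrite limg_span; apply/span_subvP => _ /mapP[_ /mapP[g _ ->] ->].
have sz : size (rpath_seq g) = p.+2 by rewrite size_tuple.
have reg : regular (rpath_seq g) := valP g.
have bdD x y : bd p.+1 (x + y) = bd p.+1 x + bd p.+1 y by exact: linearD.
rewrite bdD !bd_evec ?size_map ?regular_deck // -big_split /=.
apply: memv_suml => q _; rewrite -scalerDr memvZ // face_map.
by rewrite evec_deck_rel // size_face sz.
Qed.

Lemma sbd_pi p x :
  sbd p (vquot_pi (deck_rel p) x) = vquot_pi (deck_rel p.-1) (bd p x).
Proof. exact/vquot_mapE/bd_deck_rel. Qed.

Lemma sum_face_irregular p (s : seq (lvertex V)) :
  size s = p.+2 -> ~~ regular s ->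
  \sum_(q < p.+2) (-1) ^+ q *: evec p (face q s) = 0.
Proof.
move=> sz /irregularP[s1 [x [s2 sE]]].
have lt1 : (size s1 < p.+2)%N by rewrite -sz sE size_cat /= addnS leq_addr.
have lt2 : ((size s1).+1 < p.+2)%N.
  by rewrite -sz sE size_cat /= !addnS !ltnS leq_addr.
rewrite (bigD1 (Ordinal lt1)) //= (bigD1 (Ordinal lt2)) /=; last first.
  by rewrite -val_eqE /= (gtn_eqF (ltnSn _)).
have <- : face (size s1) s = face (size s1).+1 s.
  rewrite sE; elim: (s1) => [|y t IH]; rewrite /= ?faceS ?face0 //.
  by rewrite IH.
rewrite exprS mulN1r scaleNr addrA subrr add0r big1 // => q.
rewrite -!val_eqE /= => /andP[n1 n2]; rewrite evec_irregular ?scaler0 //.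
have [lt|ge] := ltnP q (size s1).
  rewrite sE /face take_cat lt drop_cat.
  case: ltnP => [_|le]; first by rewrite catA irregular_cat.
  have -> : (q.+1 - size s1 = 0)%N by apply/eqP; rewrite subn_eq0.
  by rewrite drop0 irregular_cat.
have gt : ((size s1).+1 < q)%N.
  by rewrite ltn_neqAle eq_sym n2 ltn_neqAle eq_sym n1.
have -> : face q s = s1 ++ x :: x :: face (q - (size s1).+2) s2.
  rewrite sE -[in face q _](subnKC gt); move: (q - _)%N => k.
  by elim: (s1) => [|y t IH] //=; rewrite addSn faceS IH.
exact: irregular_cat.
Qed.

Lemma bd_sum_face p (s : seq (lvertex V)) : size s = p.+2 ->
  bd p.+1 (evec p.+1 s) = \sum_(q < p.+2) (-1) ^+ q *: evec p (face q s).
Proof.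
move=> sz; have [reg|irr] := boolP (regular s); first exact: bd_evec.
by rewrite sum_face_irregular // evec_irregular // linear0.
Qed.

Lemma sum_face_face p (s : seq (lvertex V)) :
  \sum_(q < p.+3) (-1) ^+ q *:
     \sum_(r < p.+2) (-1) ^+ r *: evec p (face r (face q s)) = 0.
Proof.
pose F (u : 'I_p.+3 * 'I_p.+2) :=
  (-1) ^+ (u.1 + u.2) *: evec p (face u.2 (face u.1 s)).
transitivity (\sum_u F u).
  rewrite -(pair_bigA _ (fun q r => F (q, r))) /=.
  apply: eq_bigr => q _; rewrite scaler_sumr; apply: eq_bigr => r _.
  by rewrite /F scalerA exprD.
rewrite (bigID (fun u : 'I_p.+3 * 'I_p.+2 => (u.2 < u.1)%N)) /=.
pose h (u : 'I_p.+3 * 'I_p.+2) : 'I_p.+3 * 'I_p.+2 :=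
  (lift ord0 u.2, inord u.1).
pose h' (u : 'I_p.+3 * 'I_p.+2) : 'I_p.+3 * 'I_p.+2 :=
  (inord u.2, inord (u.1).-1).
rewrite (reindex_onto h h') /=; last first.
  case=> q r /= rq; rewrite /h /h' /=.
  have q1 : (q.-1 < p.+2)%N by rewrite -ltnS prednK ?(leq_ltn_trans _ rq).
  congr pair; apply/val_inj.
    by rewrite /= inordK // /bump leq0n add1n prednK ?(leq_ltn_trans _ rq).
  by rewrite /= [X in inord X]inordK ?(ltn_trans (ltn_ord r)) // inord_val.
apply/eqP; rewrite addr_eq0 -sumrN; apply/eqP.
apply: eq_big => [[a b]|[a b]] /=; rewrite /bump leq0n add1n /=.
  rewrite -leqNgt; have [le|lt] := leqP a b.
    have a2 : (a < p.+2)%N := leq_ltn_trans le (ltn_ord b).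
    rewrite inordK // ltnS le; apply/eqP; congr pair.
      by apply/val_inj; rewrite /= inordK ?inordK // ltnW.
    by rewrite /h /= inord_val.
  apply/negP => /andP[+ /eqP[/(congr1 val) /= Ea _]].
  rewrite inordK in Ea; last exact: ltnW (ltn_ord _).
  by rewrite Ea ltnS leqNgt lt.
case/andP=> ab /eqP[/(congr1 val) /= Ea _].
rewrite inordK in Ea; last exact: ltnW (ltn_ord _).
rewrite Ea ltnS in ab. rewrite /F /= Ea /bump leq0n add1n face_face //.
by rewrite addSn exprS mulN1r scaleNr addnC.
Qed.

Lemma bd_bd p (x : rchain p.+1) : bd p (bd p.+1 x) = 0.
Proof.
case: p x => [|p] x; first by rewrite /= zero_lfunE.
have bdE : bd p.+2 x = \sum_(g : rpath V p.+2)
    x g *: \sum_(q < p.+3) (-1) ^+ q *: evec p.+1 (face q (rpath_seq g)).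
  by rewrite lfunE.
have -> : bd p.+1 (bd p.+2 x) = \sum_(g : rpath V p.+2)
    x g *: \sum_(q < p.+3)
      (-1) ^+ q *: bd p.+1 (evec p.+1 (face q (rpath_seq g))).
  rewrite bdE linear_sum; apply: eq_bigr => g _; rewrite linearZ; congr (_ *: _).
  by rewrite linear_sum; apply: eq_bigr => q _; rewrite linearZ.
rewrite big1 // => g _.
rewrite -[RHS](scaler0 _ (x g)); congr (_ *: _).
rewrite -[RHS](sum_face_face p (rpath_seq g)); apply: eq_bigr => q _.
by rewrite bd_sum_face // size_face size_tuple.
Qed.

Lemma sbd_sbd p (z : schain p.+1) : sbd p (sbd p.+1 z) = 0.
Proof.
rewrite -[z]vquot_reprK.
have -> : sbd p.+1 (vquot_pi (deck_rel p.+1) (repr z)) =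
    vquot_pi (deck_rel p) (bd p.+1 (repr z)) by exact: sbd_pi.
by rewrite sbd_pi bd_bd linear0.
Qed.

Variable D : sdigraph V.

(* Ranging over regular paths loses nothing: D is loopless, so allowed paths are
   regular. *)
Definition allowed_space (p : nat) : {vspace schain p} :=
  <<[seq sclass p (rpath_seq g)
    | g <- enum (rpath V p) & allowed D (rpath_seq g)]>>%VS.

Definition Omega (p : nat) : {vspace schain p} :=
  match p with
  | 0 => allowed_space 0
  | p'.+1 => (allowed_space p'.+1 :&: sbd p'.+1 @^-1: allowed_space p')%VS
  end.

Definition cycles (p : nat) : {vspace schain p} := (Omega p :&: lker (sbd p))%VS.

Definition boundaries (p : nat) : {vspace schain p} :=
  (sbd p.+1 @: Omega p.+1)%VS.

Lemma boundaries_sub p : (boundaries p <= cycles p)%VS.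
Proof.
apply/subvP => y /memv_imgP[z]; rewrite memv_cap => /andP[_ zO] yE.
rewrite memv_cap memv_ker; apply/andP; split; last by rewrite yE sbd_sbd.
case: p z y yE zO => [|p] z y yE; rewrite -memv_preim -yE // => yA.
by rewrite memv_cap yA -memv_preim yE sbd_sbd mem0v.
Qed.

(* Cycles modulo boundaries, the boundaries being seen as a subspace of the
   space of cycles. *)
Definition homology (p : nat) : vectType R :=
  vquot (linfun (@vsval R (schain p) (cycles p)) @^-1: boundaries p)%VS.

End SignedGLMY.

Definition canonical_homology (R : fieldType) (V : finType) (S : sgraph V)
    (p : nat) : vectType R :=
  homology R (bidirected S) p.

(* Main.v *)
(* Let [x ~ y] mean that the lifted vertices [x] and [y] are connected in the
   signed double cover.  A lifted vertex [x] gives the vector [cover_vec x], which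
   is [1] at the [v] with [x ~ v^+], [-1] at the [v] with [x ~ v^-], and [0] when
   both or neither hold.  By the sum-of-squares form of the Laplacian, its kernel
   consists of the vectors [z] with [z u = sign(uv) z v] on every edge, and the
   [cover_vec (r, +)], with [r] ranging over component representatives, span it.
   The map [x |-> cover_vec x] on 0-chains kills exactly what the projection onto
   degree-0 homology kills, which gives the isomorphism.  Finally, [r^+ ~ r^-]
   holds exactly when the component of [r] contains a negative cycle, so the
   balanced components are those with [cover_vec (r, +) != 0]. *)
From HB Require Import structures.
Require Import Defs.
From mathcomp Require Import all_boot all_order all_algebra.
From mathcomp Require Import boolp reals.
From mathcomp Require Import zify ring.

Set Implicit Arguments.
Unset Strict Implicit.
Unset Printing Implicit Defensive.

Import Order.TTheory GRing.Theory Num.Theory.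
Local Open Scope ring_scope.

(** * Connectivity in the signed double cover and balance of components *)

Section Cover.
Variables (V : finType) (S : sgraph V).

Local Notation e := (sg_edge S).
Local Notation cov := (cover_arrow (bidirected S)).

Lemma cover_arrow_sym : symmetric cov.
Proof.
move=> x y; rewrite /cover_arrow /= sg_edge_sym; have [exy|//] := boolP (e y.1 x.1).
rewrite (sg_sign_sym exy) /=.
by case: x.2 y.2 (sg_sign S _ _) => [] [] [].
Qed.

Lemma cover_connect_sym : connect_sym cov.
Proof. exact/sym_connect_sym/cover_arrow_sym. Qed.

Lemma edge_connect_sym : connect_sym e.
Proof. exact/sym_connect_sym/sg_edge_sym. Qed.

Lemma cover_arrow_deck x y : cov (deck x) (deck y) = cov x y.
Proof.
by rewrite /cover_arrow /= addNb (inj_eq negb_inj).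
Qed.

Lemma cover_connect_deck x y : connect cov (deck x) (deck y) = connect cov x y.
Proof.
suff imp u w : connect cov u w -> connect cov (deck u) (deck w).
  by apply/idP/idP => /imp //; rewrite !deckK.
case/connectP => p; elim: p u => [u _ -> //|z p IH] u /= /andP[uz zp] lst.
apply: connect_trans (IH z zp lst); apply: connect1.
by rewrite cover_arrow_deck.
Qed.

(** The sign of each edge dictates the level of the next lifted vertex, so the starting level can be
    chosen freely. *)
Lemma lift_path u b p : path e u p ->
  exists2 q, path cov (u, b) q & [seq x.1 | x <- q] = p.
Proof.
elim: p u b => [|w p IH] u b /=; first by exists [::].
case/andP=> uw /(IH _ (b (+) sg_sign S u w)) [q wq qp].
exists ((w, b (+) sg_sign S u w) :: q); rewrite /= ?qp //.
by rewrite wq /cover_arrow /= uw eqxx.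
Qed.

Lemma path_proj x q : path cov x q -> path e x.1 [seq z.1 | z <- q].
Proof. by apply: homo_path => y z /andP[]. Qed.

Lemma connect_proj x y : connect cov x y -> connect e x.1 y.1.
Proof.
case/connectP=> q /path_proj xq ->; apply/connectP.
by exists [seq z.1 | z <- q]; rewrite ?last_map.
Qed.

Lemma connect_lift u b w : connect e u w -> exists c, connect cov (u, b) (w, c).
Proof.
case/connectP=> p /(lift_path b) [q uq <-] ->.
rewrite (last_map fst q (u, b)); exists (last (u, b) q).2.
by rewrite -surjective_pairing; apply/connectP; exists q.
Qed.

(** The sign of an arrow is the difference of the levels of its ends, so the product telescopes.
    Uniqueness makes [next_at] the successor along the path, with [z.1] following the last vertex;
    when [z.1 = y.1] the product is a cycle sign. *)
Lemma cover_path_sign y q z :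
  path cov y (rcons q z) -> uniq (y.1 :: [seq x.1 | x <- q]) ->
  \prod_(v <- y.1 :: [seq x.1 | x <- q])
     (-1) ^+ sg_sign S v (next_at v z.1 y.1 [seq x.1 | x <- q])
    = (-1) ^+ (y.2 (+) z.2) :> int.
Proof.
elim: q y => [|w q IH] y /=.
  case/andP=> /andP[_ /eqP z2] _ _.
  by rewrite big_seq1 eqxx z2 addbA addbb.
case/andP=> /andP[_ /eqP /= w2] wq /andP[yn un].
rewrite big_cons eqxx.
have := IH _ wq un; rewrite big_seq => IHw.
rewrite big_seq (eq_bigr (fun v => (-1) ^+
    sg_sign S v (next_at v z.1 w.1 [seq x.1 | x <- q]))); last first.
  by move=> v vin; rewrite [_ == y.1](negbTE (memPn yn v vin)).
by rewrite IHw w2 -signr_addb -addbA addbCA [in X in _ (+) X]addbA addbb.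
Qed.

(* A shortest closed walk of the cover from [x] to its mirror image projects to
   a cycle: if the projection repeats a vertex, the part between the two visits
   either closes up in the cover, and can be cut out, or is a shorter such walk. *)
Lemma negative_cycle x : connect cov x (deck x) ->
  exists c, [/\ is_cycle S c, cycle_sign S c != 1 &
                {in c, forall v, connect e x.1 v}].
Proof.
case/connectP=> q; have [n] := ubnP (size q).
elim: n q x => // n IH q x; rewrite ltnS => szq xq xlast.
have [uq|nuq] := boolP (uniq [seq z.1 | z <- q]).
  case/lastP: q => [|q z] in szq xq xlast uq *.
    by case: x xlast {xq} => u [].
  rewrite last_rcons in xlast; rewrite -xlast in xq uq.
  have uc : uniq (x.1 :: [seq z.1 | z <- q]).
    by rewrite map_rcons rcons_uniq in uq.
  exists (x.1 :: [seq z.1 | z <- q]); split.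
  - rewrite /is_cycle uc andbT; apply/andP; split; last first.
      by have := path_proj xq; rewrite /= map_rcons.
    (* Length 1 would need a loop; length 2 would traverse one edge back and forth, and its two
       equal signs would return to the level of [x]. *)
    case: q xq {IH szq uq uc xlast} => [|w [|w' q]] //=.
      by rewrite /cover_arrow /= sg_edge_irr.
    rewrite /cover_arrow /= andbT => /andP[/andP[xw /eqP->] /andP[_ ]].
    by rewrite -(sg_sign_sym xw) addbK; case: x.2.
  - have := cover_path_sign xq uc; rewrite /cycle_sign /= => ->.
    by rewrite addbN addbb.
  - move=> v; rewrite inE => /orP[/eqP->|vq]; first exact: connect0.
    have /= := path_connect (path_proj xq); apply.
    by rewrite map_rcons inE mem_rcons inE vq !orbT.
have [q1 [q2 [q3 [v [b [c qE]]]]]] : exists q1 q2 q3 v b c,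
    q = q1 ++ (v, b) :: q2 ++ (v, c) :: q3.
  elim: q nuq {szq xq xlast} => //= -[v b] q IHq; rewrite negb_and negbK.
  case/orP=> [|/IHq[q1 [q2 [q3 [w [b' [c ->]]]]]]].
    case/mapP=> -[w c] + /= -> => /splitPr[q2 q3].
    by exists [::], q2, q3, w, b, c.
  by exists ((v, b) :: q1), q2, q3, w, b', c.
move: xq xlast; rewrite qE cat_path last_cat /= cat_path last_cat /=.
case/and5P=> xq1 q1v vq2 q2v vq3 xlast.
have [bc|bc] := eqVneq b c.
  apply: (IH (q1 ++ (v, b) :: q3)).
  - by apply: leq_trans szq; rewrite qE 2!size_cat /= size_cat /=; lia.
  - by rewrite cat_path xq1 /= q1v bc vq3.
  - by rewrite last_cat /= bc.
have [||//|d [dcyc dsign dconn]] := IH (rcons q2 (v, c)) (v, b).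
- by apply: leq_trans szq; rewrite qE size_cat /= size_cat /= size_rcons; lia.
- by rewrite rcons_path vq2.
- by rewrite last_rcons /deck /=; case: b c bc {qE xq1 q1v vq2 q2v vq3 xlast} => [] [].
exists d; split=> // w /dconn; apply: connect_trans => /=.
apply: (@connect_trans _ _ (last x q1).1); last first.
  by apply: connect1; case/andP: q1v.
by apply: (connect_proj (y := last x q1)); apply/connectP; exists q1.
Qed.

(** One direction projects a walk by [negative_cycle]; the other lifts a cycle, and a negative one
    ends on the opposite level. *)
Lemma balancedP r : balanced S [set v | connect e r v] <->
  ~~ connect cov (r, false) (r, true).
Proof.
split=> [bal|/negP nconn c].
  apply/negP => /(negative_cycle (x := (r, false))) /= [c [ccyc csign crC]].
  case/eqP: csign; apply: bal => // v /crC.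
  by rewrite inE.
case: c => [|v p] // /and3P[_ vp un] pC.
have [q vq qp] := lift_path false vp.
case/lastP: q => [|q z] in vq qp *; first by move/(congr1 size): qp; rewrite size_rcons.
move: qp; rewrite map_rcons => /eqP; rewrite eqseq_rcons => /andP[/eqP qp /eqP zv].
have := cover_path_sign vq; rewrite /= qp zv => /(_ un).
rewrite /cycle_sign /= => ->; case z2: z.2 => //; case: nconn.
have rv : connect e r v by have := pC v (mem_head _ _); rewrite inE.
have [b rb] := connect_lift false rv.
have vz : connect cov (v, false) (v, true).
  apply/connectP; exists (rcons q z); rewrite ?last_rcons //.
  by rewrite -zv -z2 -surjective_pairing.
have vb : connect cov (v, b) (v, ~~ b).
  by case: b {rb} => //; rewrite cover_connect_sym.
(* The deck image of the path from [(r, false)] to [(v, b)] joins [(r, true)] to [(v, ~~ b)]. *)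
apply: connect_trans (connect_trans rb vb) _.
by rewrite cover_connect_sym -cover_connect_deck /deck /= negbK.
Qed.

Lemma card_balanced_components :
  #|[set C in components S | `[< balanced S C >]]| =
  #|[set r | roots e r && ~~ connect cov (r, false) (r, true)]|.
Proof.
have cardi : {in [set r | roots e r && ~~ connect cov (r, false) (r, true)] &,
    injective (fun r => [set v | connect e r v])}.
  move=> r s; rewrite !inE => /andP[/eqP rr _] /andP[/eqP rs _] /setP /(_ s).
  rewrite !inE connect0 -(root_connect edge_connect_sym) rr rs.
  by move/eqP.
rewrite -(card_in_imset cardi); apply: eq_card => C; rewrite !inE.
apply/andP/imsetP.
  case=> /imsetP[v _ ->] /asboolP bal; exists (fingraph.root e v).
    rewrite inE roots_root /=; last exact: edge_connect_sym.
    apply/balancedP; move: bal; rewrite (_ : [set _ in _ | _] =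
      [set w | connect e (fingraph.root e v) w]) //.
    apply/setP=> w; rewrite !inE.
    by rewrite -(same_connect edge_connect_sym (connect_root e v)).
  apply/setP=> w; rewrite !inE.
  by rewrite -(same_connect edge_connect_sym (connect_root e v)).
case=> r; rewrite inE => /andP[_ /balancedP bal] ->; split; last exact/asboolP.
by apply/imsetP; exists r => //; apply/setP=> w; rewrite !inE.
Qed.

End Cover.

(** * The Laplacian kernel, its spanning vectors and its dimension *)

Section Kernel.
Variables (R : realFieldType) (V : finType) (S : sgraph V).

Local Notation e := (sg_edge S).
Local Notation s := (sg_sign S).
Local Notation cov := (cover_arrow (bidirected S)).
Local Notation L := (laplacian S R).

Lemma laplacianE (x : {ffun V -> R^o}) u :
  L x u = \sum_(v | e u v) (x u - (-1) ^+ s u v * x v).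
Proof.
rewrite lfunE /= ffunE.
transitivity (\sum_v ((if u == v then (degree S u)%:R else 0) * x v
                         - adj_entry S R u v * x v)).
  by apply: eq_bigr => v _; rewrite -mulrBl.
rewrite !sumrB (bigD1 u) //= eqxx big1 ?addr0; last first.
  by move=> v; rewrite eq_sym => /negbTE->; rewrite mul0r.
rewrite sumr_const /degree mulr_natl; congr (_ *+ _ - _).
  by apply: eq_card => v; rewrite inE.
rewrite [RHS]big_mkcond; apply: eq_bigr => v _.
by rewrite /adj_entry; case: ifP; rewrite ?mul0r.
Qed.

(* Summing [x u * (L x) u] over [u] gives half the sum of the squares of the
   [x u - s u v * x v] over the ordered pairs of adjacent vertices. *)
Lemma lker_laplacianP (x : {ffun V -> R^o}) :
  reflect (forall u v, e u v -> x u = (-1) ^+ s u v * x v) (x \in lker L).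
Proof.
rewrite memv_ker; apply: (iffP eqP) => [Lx0 u v euv|xe]; last first.
  apply/ffunP=> u; rewrite laplacianE [RHS]ffunE big1 // => v /xe {1}->.
  exact: subrr.
pose t u v := x u - (-1) ^+ s u v * x v.
have xt0 : \sum_u \sum_(v | e u v) x u * t u v = 0.
  by rewrite big1 // => w _; rewrite -mulr_sumr -laplacianE Lx0 ffunE mulr0.
have sq0 : \sum_u \sum_(v | e u v) t u v ^+ 2 = 0.
  transitivity (\sum_u \sum_(v | e u v) (x u * t u v + x v * t v u)).
    apply: eq_bigr => w _; apply: eq_bigr => z /sg_sign_sym ezw.
    rewrite /t -ezw; case: (s w z); rewrite ?expr0 ?expr1; ring.
  under eq_bigr do rewrite big_split /=.
  rewrite big_split /= xt0 add0r (exchange_big_dep predT) //= -[RHS]xt0.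
  by apply: eq_bigr => w _; apply: eq_bigl => z; rewrite sg_edge_sym.
apply/eqP; rewrite -subr_eq0 -sqrf_eq0 -/(t u v); apply/eqP.
have ge0 w z : 0 <= t w z ^+ 2 by exact: sqr_ge0.
have/(psumr_eq0P (fun w _ => sumr_ge0 _ (fun z _ => ge0 w z))) := sq0.
by move/(_ u isT)/psumr_eq0P; apply.
Qed.

(** A kernel vector lifts to an odd function on the cover, and the edge equations say that this
    function is constant along arrows. *)
Lemma lker_connect z x y : z \in lker L -> connect cov x y ->
  (-1) ^+ x.2 * z x.1 = (-1) ^+ y.2 * z y.1.
Proof.
move/lker_laplacianP=> zL /connectP[p xp ->] {y}.
elim: p x xp => //= w p IH x /andP[/andP[xw /eqP w2] /IH <-].
by rewrite (zL _ _ xw) w2 signr_addb mulrA.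
Qed.

Definition cover_vec (x : lvertex V) : {ffun V -> R^o} :=
  [ffun v => (connect cov x (v, false))%:R - (connect cov x (v, true))%:R].

Lemma cover_vec_connect x y : connect cov x y -> cover_vec x = cover_vec y.
Proof.
move=> xy; apply/ffunP=> v.
by rewrite !ffunE !(same_connect (cover_connect_sym S) xy).
Qed.

Lemma cover_vec_deck x : cover_vec (deck x) = - cover_vec x.
Proof.
have flip v b : connect cov (deck x) (v, b) = connect cov x (v, ~~ b).
  by rewrite -cover_connect_deck deckK.
by apply/ffunP=> v; rewrite !ffunE !flip opprB.
Qed.

Lemma cover_vec_lker x : cover_vec x \in lker L.
Proof.
apply/lker_laplacianP => u v euv.
have step b : connect cov x (u, b) = connect cov x (v, b (+) s u v).
  have uv : connect cov (u, b) (v, b (+) s u v).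
    by apply: connect1; rewrite /cover_arrow /= euv eqxx.
  by rewrite !(cover_connect_sym S x) (same_connect (cover_connect_sym S) uv).
(* A negative edge swaps the two indicators, which negates their difference. *)
rewrite !ffunE !step; case: (s u v); rewrite /= ?mul1r //.
by rewrite mulN1r opprB.
Qed.

Lemma lker_root z v : z \in lker L ->
  z v = z (fingraph.root e v) * cover_vec (fingraph.root e v, false) v.
Proof.
move=> zL; set r := fingraph.root e v.
have [c rc] : exists c, connect cov (r, false) (v, c).
  apply: connect_lift; rewrite (edge_connect_sym S); exact: connect_root.
have := lker_connect zL rc; rewrite /= mul1r => zr.
(* If [(r, false)] reaches both lifts of [v], then [z v] equals its own opposite, and both sides
   vanish. *)
have [rc'|rc'] := boolP (connect cov (r, false) (v, ~~ c)).
  have zv0 : z v = 0.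
    have := lker_connect zL rc'; rewrite /= mul1r zr => /eqP.
    rewrite -subr_eq0; case: c {zr rc rc'}; rewrite /= ?expr0 ?expr1.
      by rewrite mulN1r mul1r -opprD oppr_eq0 -mulr2n mulrn_eq0 => /eqP.
    by rewrite mulN1r mul1r opprK -mulr2n mulrn_eq0 => /eqP.
  by rewrite zr zv0 mulr0 mul0r.
rewrite ffunE zr; case: c {zr} rc rc' => /= -> /negbTE->;
 by rewrite ?mulN1r ?mul1r ?sub0r ?subr0 ?mulr1 ?mulrN1 ?opprK.
Qed.

Lemma cover_vec_outside x v : ~~ connect e x.1 v -> cover_vec x v = 0.
Proof.
move=> nxv; have nconn b : connect cov x (v, b) = false.
  by apply: contraNF nxv => /connect_proj.
by rewrite ffunE !nconn subrr.
Qed.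

Lemma lker_cover_vec z : z \in lker L ->
  z = \sum_(r | fingraph.roots e r) z r *: cover_vec (r, false).
Proof.
move=> zL; apply/ffunP=> v; rewrite sum_ffunE.
rewrite (bigD1 (fingraph.root e v)) ?roots_root //=; last exact: edge_connect_sym.
rewrite big1 ?addr0; first by rewrite [RHS]ffunE; exact: lker_root.
move=> r /andP[/eqP rr rv]; rewrite ffunE cover_vec_outside ?scaler0 //=.
by rewrite -(root_connect (edge_connect_sym S)) rr.
Qed.

(** Evaluation at the roots in [B] is an isomorphism on the kernel. It is injective because
    [z r = - z r] at every other root, and onto because [cover_vec (r, false)], for [r] in [B], is 1
    at [r] and 0 at the other roots. *)
Lemma dim_lker_laplacian :
  \dim (lker L) =
    #|[set r | fingraph.roots e r && ~~ connect cov (r, false) (r, true)]|.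
Proof.
set B := [set r | _].
pose ev_fun (z : {ffun V -> R^o}) : {ffun {r | r \in B} -> R^o} :=
  [ffun r => z (val r)].
have ev_lin : linear ev_fun by move=> a x y; apply/ffunP=> r; rewrite !ffunE.
pose evM := GRing.isLinear.Build _ _ _ _ ev_fun ev_lin.
pose ev := linfun (HB.pack_for {linear _ -> _} ev_fun evM).
have ker0 : (lker L :&: lker ev = 0)%VS.
  apply/eqP; rewrite -subv0; apply/subvP=> z; rewrite memv_cap memv0.
  case/andP=> zL; rewrite memv_ker => /eqP z0.
  apply/eqP; rewrite (lker_cover_vec zL) big1 // => r rr.
  have [rB|rB] := boolP (r \in B).
    move/ffunP/(_ (exist _ r rB)): z0; rewrite lfunE !ffunE /= => ->.
    by rewrite scale0r.
  move: rB; rewrite inE rr negbK /= => conn.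
  have := lker_connect zL conn; rewrite /= mul1r mulN1r => /eqP.
  by rewrite -addr_eq0 -mulr2n mulrn_eq0 => /eqP->; rewrite scale0r.
have img : (ev @: lker L = fullv)%VS.
  apply/eqP; rewrite eqEsubv subvf /=; apply/subvP=> y _; apply/memv_imgP.
  exists (\sum_(r : {r | r \in B}) y r *: cover_vec (val r, false)).
    by apply: memv_suml => r _; rewrite memvZ ?cover_vec_lker.
  rewrite lfunE; apply/ffunP=> r; rewrite ffunE sum_ffunE (bigD1 r) //= big1.
    rewrite addr0 ffunE ffunE connect0.
    have := valP r; rewrite inE => /andP[_ /negbTE->].
    by rewrite subr0; exact/esym/mulr1.
  move=> q qr; rewrite ffunE cover_vec_outside ?scaler0 //=.
  have := valP r; have := valP q; rewrite !inE => /andP[/eqP qq _] /andP[/eqP r' _].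
  by rewrite -(root_connect (edge_connect_sym S)) qq r'.
rewrite -(limg_dim_eq ker0) img dimvf -[RHS]muln1 -[in RHS]card_sig.
by [].
Qed.

End Kernel.

(** * Linear maps out of quotients *)

Lemma vquot_liftE (K : fieldType) (vT wT : vectType K) (U : {vspace vT})
    (f : 'Hom(vT, wT)) x : (U <= lker f)%VS ->
  (f \o (linfun (vquot_pi U))^-1)%VF (vquot_pi U x) = f x.
Proof.
move=> Uf; rewrite comp_lfunE; set y := ((linfun (vquot_pi U))^-1)%VF _.
(* [y] is just some preimage: it differs from [x] by an element of [U], which [f] kills. *)
have piy : vquot_pi U y = vquot_pi U x.
  have: vquot_pi U x \in limg (linfun (vquot_pi U)).
    by apply/memv_imgP; exists x; rewrite ?memvf ?lfunE.
  by move/limg_lfunVK; rewrite lfunE.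
apply/eqP; rewrite -subr_eq0 -linearB -memv_ker (subvP Uf) //.
by rewrite -vquot_piE piy.
Qed.

(** Both [bT] and [limg g] are copies of [aT] modulo the common kernel. This compares homology with
    the Laplacian kernel through maps defined on chains. *)
Lemma eq_lker_limg_iso (K : fieldType) (aT bT cT : vectType K)
    (f : 'Hom(aT, bT)) (g : 'Hom(aT, cT)) :
  limg f = fullv -> lker f = lker g ->
  exists h : {linear bT -> subvs_of (limg g)}, bijective h.
Proof.
move=> f_onto kerfg.
have swap (dT eT : vectType K) (u : 'Hom(aT, dT)) (v : 'Hom(aT, eT)) x :
    lker u = lker v -> v ((u^-1)%VF (u x)) = v x.
  move=> kuv; apply/eqP; rewrite -subr_eq0 -linearB -memv_ker -kuv memv_ker.
  by rewrite linearB /= limg_lfunVK ?subrr // memv_img ?memvf.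
pose h := (linfun (vsproj (limg g)) \o g \o f^-1)%VF.
exists h, (fun c => f ((g^-1)%VF (vsval c))) => [b|c].
  have /memv_imgP[a _ ->] : b \in limg f by rewrite f_onto memvf.
  rewrite /h /= !comp_lfunE lfunE /= vsprojK ?memv_img ?memvf //.
  by rewrite (swap _ _ f g) // (swap _ _ g f).
rewrite /h /= !comp_lfunE lfunE /= (swap _ _ f g) // limg_lfunVK ?subvsP //.
exact: vsvalK.
Qed.

(** * Degree-0 homology of a signed digraph as a quotient of the 0-chains *)

Section DegreeZero.
Variables (R : fieldType) (V : finType).

Local Notation C0 := (rchain R V 0).
Local Notation vtx x := (evec R 0 [:: x]).

Lemma rpath0E (g : rpath V 0) : rpath_seq g = [:: thead (val g)].
Proof. by rewrite /rpath_seq {1}[val g]tuple_eta; case: (val g) => -[|? []]. Qed.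

Lemma rchain0E (y : C0) : y = \sum_g y g *: vtx (thead (val g)).
Proof.
apply/ffunP=> h; rewrite sum_ffunE (bigD1 h) //= big1 ?addr0.
  by rewrite !ffunE rpath0E eqxx; exact/esym/mulr1.
move=> g gh; rewrite !ffunE -rpath0E (_ : (_ == _) = false) ?scaler0 //.
by apply: contraNF gh => /eqP hg; apply/eqP/val_inj/val_inj.
Qed.

Lemma lfun_rchain0P (wT : vectType R) (f g : 'Hom(C0, wT)) :
  (forall x, f (vtx x) = g (vtx x)) -> f = g.
Proof.
move=> fg; apply/lfunP=> y; rewrite [y]rchain0E !linear_sum.
by apply: eq_bigr => h _; rewrite !linearZ /= fg.
Qed.

(** The linear extension of [t], lifted vertices being the basis of the 0-chains. *)
Definition vertex_map_fun (wT : vectType R) (t : lvertex V -> wT) (y : C0) :=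
  \sum_g y g *: t (thead (val g)).

Fact vertex_map_is_linear (wT : vectType R) t : linear (@vertex_map_fun wT t).
Proof.
move=> a y z; rewrite /vertex_map_fun scaler_sumr -big_split.
by apply: eq_bigr => g _; rewrite !ffunE scalerDl scalerA.
Qed.
HB.instance Definition _ wT t :=
  GRing.isLinear.Build R _ _ *:%R (@vertex_map_fun wT t)
    (@vertex_map_is_linear wT t).

Definition vertex_map (wT : vectType R) (t : lvertex V -> wT) : 'Hom(C0, wT) :=
  linfun (vertex_map_fun t).

Lemma vertex_mapE (wT : vectType R) (t : lvertex V -> wT) x :
  vertex_map t (vtx x) = t x.
Proof.
have [//|//|g gx] := @rpathP V 0 [:: x].
rewrite lfunE /= /vertex_map_fun (bigD1 g) //= ffunE gx eqxx scale1r big1.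
  by move: gx; rewrite addr0 rpath0E => -[->].
move=> h hg; rewrite ffunE (_ : (_ == _) = false) ?scale0r //.
apply: contraNF hg => /eqP hx; apply/eqP/val_inj/val_inj.
exact: etrans hx (esym gx).
Qed.

Lemma deck_rel0_sub (wT : vectType R) (f : 'Hom(C0, wT)) :
  (forall x, f (vtx (deck x)) = - f (vtx x)) -> (deck_rel R V 0 <= lker f)%VS.
Proof.
move=> fd; apply/span_subvP => _ /mapP[g _ ->].
by rewrite rpath0E memv_ker linearD /= fd addNr.
Qed.

Variable D : sdigraph V.
Local Notation H0 := (homology R D 0).
Local Notation pi0 := (vquot_pi (deck_rel R V 0)).

Lemma allowed_space0 : allowed_space R D 0 = fullv.
Proof.
apply/eqP; rewrite eqEsubv subvf /=; apply/subvP=> q _.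
rewrite -[q]vquot_reprK [repr q]rchain0E linear_sum memv_suml // => g _.
rewrite linearZ memvZ // -rpath0E memv_span //.
by apply/mapP; exists g; rewrite // mem_filter mem_enum rpath0E.
Qed.

Lemma cycles0 : cycles R D 0 = fullv.
Proof.
rewrite /cycles /= allowed_space0 capfv; apply/eqP; rewrite eqEsubv subvf /=.
apply/subvP=> q _; rewrite memv_ker -[q]vquot_reprK sbd_pi /= zero_lfunE.
by rewrite linear0.
Qed.

Lemma sbd_edge x y : x != y ->
  sbd R V 1 (sclass R 1 [:: x; y]) = pi0 (vtx y) - pi0 (vtx x).
Proof.
move=> xy; rewrite sbd_pi bd_evec //; last by rewrite /regular /= xy.
rewrite 2!big_ord_recl big_ord0 addr0 /= expr0 expr1 scale1r scaleN1r.
by rewrite linearB.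
Qed.

Lemma cover_arrow_irr : irreflexive (cover_arrow D).
Proof. by move=> x; rewrite /cover_arrow sd_arrow_irr. Qed.

(** The arrow itself lies in [Omega] in degree 1, since the condition on its boundary is void: all
    of degree 0 is allowed. *)
Lemma boundaries0_arrow x y :
  cover_arrow D x y -> pi0 (vtx y) - pi0 (vtx x) \in boundaries R D 0.
Proof.
move=> xy; have neq : x != y by apply: contraTneq xy => ->; rewrite cover_arrow_irr.
rewrite -(sbd_edge neq) memv_img //= memv_cap; apply/andP; split.
  have [|g gx] := @rpathP V 1 [:: x; y] erefl; first by rewrite /regular /= neq.
  rewrite -gx memv_span //; apply/mapP; exists g => //.
  by rewrite mem_filter mem_enum gx /allowed /= xy.
by rewrite -memv_preim allowed_space0 memvf.
Qed.

(** Allowed 1-paths are single arrows, so the differences of [boundaries0_arrow] span all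
    boundaries. *)
Lemma boundaries0_sub (wT : vectType R) (f : 'Hom(schain R V 0, wT)) :
  (forall x y, cover_arrow D x y -> f (pi0 (vtx x)) = f (pi0 (vtx y))) ->
  (boundaries R D 0 <= lker f)%VS.
Proof.
move=> farr; apply/subvP=> _ /memv_imgP[z + ->]; rewrite /= memv_cap => /andP[zA _].
suff: (allowed_space R D 1 <= lker (f \o sbd R V 1))%VS.
  by move/subvP/(_ z zA); rewrite !memv_ker comp_lfunE.
apply/span_subvP=> _ /mapP[g + ->]; rewrite mem_filter => /andP[ag _].
rewrite memv_ker comp_lfunE.
have := size_tuple (val g); rewrite -/(rpath_seq g).
case: (rpath_seq g) ag => [|x [|y []]] //=; rewrite /allowed /= andbT => xy _.
have neq : x != y by apply: contraTneq xy => ->; rewrite cover_arrow_irr.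
by rewrite sbd_edge // linearB /= (farr _ _ xy) subrr.
Qed.

(** The projection onto homology; [vsproj] loses nothing because every class in degree 0 is a cycle,
    by [cycles0]. *)
Definition hclass_fun (y : C0) : H0 :=
  vquot_pi (linfun (@vsval R _ (cycles R D 0)) @^-1: boundaries R D 0)%VS
    (vsproj (cycles R D 0) (pi0 y)).

Fact hclass_is_linear : linear hclass_fun.
Proof. by move=> a y z; rewrite /hclass_fun !linearP. Qed.
HB.instance Definition _ :=
  GRing.isLinear.Build R _ _ *:%R hclass_fun hclass_is_linear.

Definition hclass : 'Hom(C0, H0) := linfun hclass_fun.

Lemma hclass_onto : limg hclass = fullv.
Proof.
apply/eqP; rewrite eqEsubv subvf /=; apply/subvP=> q _; apply/memv_imgP.
exists (repr (vsval (repr q))); rewrite ?memvf // lfunE /= /hclass_fun.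
by rewrite vquot_reprK vsvalK vquot_reprK.
Qed.

Lemma hclass_eq0 y : (hclass y == 0) = (pi0 y \in boundaries R D 0).
Proof.
rewrite lfunE /= /hclass_fun -[X in _ == X](linear0 (vquot_pi _)) vquot_piE.
by rewrite subr0 -memv_preim lfunE /= vsprojK // cycles0 memvf.
Qed.

Lemma hclass_deck x : hclass (vtx (deck x)) = - hclass (vtx x).
Proof.
apply/eqP; rewrite -addr_eq0 -linearD /= hclass_eq0.
have /eqP -> : pi0 (vtx (deck x) + vtx x) == 0.
  by rewrite -[X in _ == X](linear0 pi0) vquot_piE subr0 (evec_deck_rel _ (s := [:: x])).
exact: mem0v.
Qed.

Lemma hclass_connect x y :
  connect (cover_arrow D) x y -> hclass (vtx x) = hclass (vtx y).
Proof.
case/connectP=> p xp -> {y}; elim: p x xp => //= z p IH x /andP[xz /IH <-].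
by apply/eqP; rewrite eq_sym -subr_eq0 -linearB hclass_eq0 linearB boundaries0_arrow.
Qed.

(** The universal property of [hclass]: deck relations and arrow differences account for everything
    it kills. *)
Lemma lker_hclass_sub (wT : vectType R) (f : 'Hom(C0, wT)) :
  (forall x, f (vtx (deck x)) = - f (vtx x)) ->
  (forall x y, cover_arrow D x y -> f (vtx x) = f (vtx y)) ->
  (lker hclass <= lker f)%VS.
Proof.
move=> /deck_rel0_sub fd farr; apply/subvP=> y; rewrite !memv_ker hclass_eq0.
rewrite -(vquot_liftE y fd) -memv_ker; apply/subvP/boundaries0_sub => u v uv.
by rewrite !vquot_liftE // (farr _ _ uv).
Qed.

End DegreeZero.

(** * Comparison of homology classes with Laplacian kernel vectors *)

Section VertexClasses.
Variables (R : realFieldType) (V : finType) (S : sgraph V).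

Local Notation e := (sg_edge S).
Local Notation cov := (cover_arrow (bidirected S)).
Local Notation psi := (vertex_map (cover_vec R S)).
Local Notation hcl := (hclass R (bidirected S)).
Local Notation vtx x := (evec R 0 [:: x]).

Lemma limg_cover_vec : limg psi = lker (laplacian S R).
Proof.
apply/eqP; rewrite eqEsubv; apply/andP; split; apply/subvP=> z.
  case/memv_imgP=> y _ ->; rewrite [y]rchain0E linear_sum memv_suml // => g _.
  by rewrite linearZ memvZ //= vertex_mapE cover_vec_lker.
move=> /lker_cover_vec ->; apply: memv_suml => r _.
by rewrite memvZ // -vertex_mapE memv_img ?memvf.
Qed.

Lemma hclass_root x : let r := fingraph.root e x.1 in
  hcl (vtx x) = cover_vec R S x r *: hcl (vtx (r, false)).
Proof.
move=> r; have [c xc] : exists c, connect cov x (r, c).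
  by case: x @r => v b r; apply/connect_lift/connect_root.
have sgn b : hcl (vtx (r, b)) = (-1) ^+ b *: hcl (vtx (r, false)).
  by case: b; rewrite ?scale1r // scaleN1r -hclass_deck.
rewrite (hclass_connect R xc) sgn ffunE.
have [xc'|xc'] := boolP (connect cov x (r, ~~ c)); last first.
  by case: c xc xc' {sgn} => /= -> /negbTE->; rewrite ?sub0r ?subr0.
(* Here [x] reaches both lifts of [r], so their opposite classes coincide and vanish, as 2 is
   invertible. *)
have -> : hcl (vtx (r, false)) = 0; last by rewrite !scaler0.
have := hclass_connect R xc'; rewrite (hclass_connect R xc) (sgn c) (sgn (~~ c)) signrN scaleNr.
move/eqP; rewrite -addr_eq0 -scalerDl -mulr2n scaler_eq0 mulrn_eq0.
by case/orP=> [|/eqP //]; rewrite (signr_eq0 R).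
Qed.

(** The inclusion of [lker hcl] in [lker psi] is the universal property, [cover_vec] being odd under
    [deck] and constant along arrows. *)
Lemma lker_hclass : lker hcl = lker psi.
Proof.
apply/eqP; rewrite eqEsubv lker_hclass_sub /=; first last.
- move=> x y xy; rewrite !vertex_mapE.
  exact/cover_vec_connect/connect1.
- by move=> x; rewrite !vertex_mapE cover_vec_deck.
(* The class map factors through the Laplacian kernel by reading a kernel vector
   at the component representatives. *)
pose theta_fun (z : {ffun V -> R^o}) :=
  \sum_(r | fingraph.roots e r) z r *: hcl (vtx (r, false)).
have theta_lin : linear theta_fun.
  move=> a y z; rewrite /theta_fun scaler_sumr -big_split.
  by apply: eq_bigr => r _; rewrite !ffunE scalerDl scalerA.
pose thetaM := GRing.isLinear.Build _ _ _ _ theta_fun theta_lin.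
pose theta := linfun (HB.pack_for {linear _ -> _} theta_fun thetaM).
suff -> : hcl = (theta \o psi)%VF.
  by apply/subvP=> y; rewrite !memv_ker comp_lfunE => /eqP->; rewrite linear0.
apply: lfun_rchain0P => x; rewrite comp_lfunE vertex_mapE [RHS]lfunE /= /theta_fun.
rewrite (bigD1 (fingraph.root e x.1)) ?roots_root //=; last exact: edge_connect_sym.
rewrite big1 ?addr0; first exact: hclass_root.
move=> r /andP[/eqP rr rx]; rewrite cover_vec_outside ?scale0r //.
by rewrite -(root_connect (edge_connect_sym S)) rr eq_sym.
Qed.

End VertexClasses.

Theorem corollary4p3 (R : realType) (V : finType) (S : sgraph V) :
  (exists f : {linear canonical_homology R S 0 -> subvs_of (lker (laplacian S R))},
     bijective f) /\
  \dim {: canonical_homology R S 0} =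
    #|[set C in components S | `[< balanced S C >]]|.
Proof.
split.
  have := eq_lker_limg_iso (hclass_onto R (bidirected S)) (lker_hclass R S).
  by rewrite limg_cover_vec.
rewrite -(hclass_onto R (bidirected S)) card_balanced_components.
rewrite -(dim_lker_laplacian R) -limg_cover_vec.
(* Rank-nullity: with equal kernels, adding the kernel dimension turns both sides into the dimension
   of the 0-chains. *)
apply/eqP; rewrite -(eqn_add2l (\dim (lker (hclass R (bidirected S))))).
by rewrite -{1}[lker _]capfv limg_ker_dim lker_hclass -[lker _]capfv limg_ker_dim.
Qed.
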